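(* Let $h>0$ and let $A_h=\frac{1}{h^2}[-1\ \ 2\ \ -1]$ be the three-point discrete Laplacian on the infinite one-dimensional grid $h\mathbb{Z}$. The vertex-wise additive Vanka operator $M_v$ for $A_h$ is given by the stencil $$M_v=\frac{h^2}{12}\,[\,1\ \ 4\ \ 10\ \ 4\ \ 1\,].$$
   Context: Grid functions are functions $u:h\mathbb{Z}\to\mathbb{C}$. A stencil $[s_{k}]_{k}$ (finitely many nonzero entries, the centre entry being $k=0$) defines the operator $(Su)(x)=\sum_k s_k\,u(x+kh)$. Additive Vanka operator: given a family of finite subsets (patches) $\Upsilon_i$ of the grid whose union is the whole grid, let $V_i$ be the restriction of a grid function to $\Upsilon_i$, $V_i^T$ its transpose (extension by zero), and $A_i=V_iA_hV_i^T$. Then $M=\sum_i V_i^T W_i A_i^{-1}V_i$, where $W_i$ is the diagonal matrix whose entry at each grid point of $\Upsilon_i$ is the reciprocal of the number of patches containing that grid point. The vertex-wise Vanka operator $M_v$ in one dimension uses the patches $\{x_{j-1},x_j,x_{j+1}\}$, $x_j=jh$, $j\in\mathbb{Z}$ (so $A_i=\frac{1}{h^2}\begin{pmatrix}2&-1&0\\-1&2&-1\\0&-1&2\end{pmatrix}$ and $W_i=\frac13 I$). *)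

(* Defs.v *)
From HB Require Import structures.
From mathcomp Require Import all_boot all_order all_algebra finmap.
From mathcomp Require Import all_classical all_reals.
From mathcomp Require Import complex.

Set Implicit Arguments.
Unset Strict Implicit.
Unset Printing Implicit Defensive.

Import Order.TTheory GRing.Theory Num.Theory.

Local Open Scope classical_set_scope.
Local Open Scope ring_scope.

(* The grid hZ, as a set of reals; it coerces to the type of its points. *)
Definition grid (R : realType) (h : R) : set R :=
  range (fun j : int => j%:~R * h).

Lemma grid_point_subproof (R : realType) (h : R) (j : int) :
  j%:~R * h \in grid h.
Proof. by rewrite inE; exists j. Qed.

Definition grid_point (R : realType) (h : R) (j : int) : grid h :=
  SigSub (grid_point_subproof h j).

Lemma grid_shift_subproof (R : realType) (h : R) (x : grid h) (k : int) :
  val x + k%:~R * h \in grid h.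
Proof.
have := valP x; rewrite !inE => -[j _ <-].
by exists (j + k) => //; rewrite intrD mulrDl.
Qed.

Definition grid_shift (R : realType) (h : R) (x : grid h) (k : int) : grid h :=
  SigSub (grid_shift_subproof x k).

Definition gridfun (R : realType) (h : R) : Type := grid h -> R[i].

Definition stencil (R : realType) : Type := {fsfun int -> R[i] with 0}.

Definition stencil_op (R : realType) (h : R) (s : stencil R) (u : gridfun h) :
    gridfun h :=
  fun x => \sum_(k <- finsupp s) s k * u (grid_shift x k).

(* The stencil c [s_{-m} ... s_0 ... s_m] for a list of 2m+1 entries: the entry
   at position i of the list sits at offset k = i - m, the middle one at 0. *)
Definition centred_stencil (R : realType) (c : R[i]) (s : seq R[i]) :
    stencil R :=
  let m := ((size s)./2)%:Z in
  [fsfun k in [fset i%:Z - m | i in iota 0 (size s)]%fset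
    => c * s`_(absz (k + m))].

(* Local finiteness is what makes the weights of the Vanka operator (and the
   sum over all patches) meaningful when there are infinitely many patches. *)
Record patch_family (R : realType) (h : R) (I : choiceType) := PatchFamily {
  patch_set :> I -> {fset grid h};
  patch_cover : forall x : grid h, exists i, x \in patch_set i;
  patch_locally_finite :
    forall x : grid h, finite_set [set i | x \in patch_set i]
}.

(* Vectors and matrices over a patch Y are indexed through the enumeration of
   Y; the choice of the enumeration does not affect the operators below. *)
Definition patch_point (R : realType) (h : R) (Y : {fset grid h})
    (a : 'I_#|{: Y}|) : grid h :=
  val (enum_val a).

Definition patch_restrict (R : realType) (h : R) (Y : {fset grid h})
    (u : gridfun h) : 'cV[R[i]]_#|{: Y}| :=
  \col_a u (patch_point a).

Definition patch_extend (R : realType) (h : R) (Y : {fset grid h})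
    (v : 'cV[R[i]]_#|{: Y}|) : gridfun h :=
  fun x => \sum_(a | patch_point a == x) v a 0.

(* The matrix of the linear map V A V^T, column by column. *)
Definition patch_matrix (R : realType) (h : R) (A : gridfun h -> gridfun h)
    (Y : {fset grid h}) : 'M[R[i]]_#|{: Y}| :=
  \matrix_(a, b)
    patch_restrict Y (A (patch_extend (delta_mx b 0 : 'cV_#|{: Y}|))) a 0.

Definition patch_count (R : realType) (h : R) (I : choiceType)
    (Y : patch_family h I) (x : grid h) : nat :=
  #|` fset_set [set i | x \in Y i]|.

Definition patch_weight (R : realType) (h : R) (I : choiceType)
    (Y : patch_family h I) (i : I) : 'M[R[i]]_#|{: Y i}| :=
  diag_mx (\row_a ((patch_count Y (patch_point a))%:R)^-1).

(* At each x only the finitely many patches containing x contribute, so the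
   finitely supported sum over all of I is the pointwise sum of the series.
   invmx is the inverse only for a matrix in unitmx. *)
Definition vanka (R : realType) (h : R) (I : choiceType)
    (Y : patch_family h I) (A : gridfun h -> gridfun h) (u : gridfun h) :
    gridfun h :=
  fun x => \sum_(i \in [set: I])
    patch_extend
      (patch_weight Y i *m invmx (patch_matrix A (Y i)) *m
         patch_restrict (Y i) u) x.

Definition vertex_patch (R : realType) (h : R) (j : int) : {fset grid h} :=
  [fset grid_point h (j - 1); grid_point h j; grid_point h (j + 1)]%fset.

Lemma grid_point_inj (R : realType) (h : R) :
  0 < h -> injective (grid_point h).
Proof.
move=> h_gt0 j k /(congr1 val) /= /(mulIf (lt0r_neq0 h_gt0)).
exact: intr_inj.
Qed.

Lemma vertex_patch_cover (R : realType) (h : R) (x : grid h) :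
  exists j, x \in vertex_patch h j.
Proof.
have := valP x; rewrite inE => -[j _ jx]; exists j.
rewrite !inE; apply/orP; left; apply/orP; right.
by apply/eqP/val_inj; rewrite /= jx.
Qed.

Lemma vertex_patch_locally_finite (R : realType) (h : R) :
  0 < h -> forall x : grid h, finite_set [set j | x \in vertex_patch h j].
Proof.
move=> h_gt0 x; have := valP x; rewrite inE => -[k _ kx].
have -> : x = grid_point h k by apply: val_inj; rewrite /= kx.
apply: (@sub_finite_set _ _ [set` [:: k + 1; k; k - 1]]); last first.
  exact: finite_seq.
move=> j /=; rewrite !inE !(inj_eq (grid_point_inj h_gt0)).
by case/orP=> [/orP[]|] /eqP ->; rewrite ?subrK ?addrK eqxx ?orbT.
Qed.

Definition vertex_patches (R : realType) (h : R) (h_gt0 : 0 < h) :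
    patch_family h int :=
  PatchFamily (@vertex_patch_cover R h) (vertex_patch_locally_finite h_gt0).

(* Main.v *)
(* The inverse of a patch matrix is the Dirichlet Green's function of A_h on
   five consecutive grid points, (h^2/4) [3 2 1; 2 4 2; 1 2 3]. The point x_k
   is the last, middle and first point of the patches k-1, k and k+1, so the
   stencil of M_v is h^2/12 times the overlapped sum of the rows 1 2 3, 2 4 2
   and 3 2 1, each starting one point after the preceding one. *)
Require Import Defs.
From HB Require Import structures.
From mathcomp Require Import all_boot all_order all_algebra finmap.
From mathcomp Require Import all_classical all_reals.
From mathcomp Require Import complex ring zify.

Set Implicit Arguments.
Unset Strict Implicit.
Unset Printing Implicit Defensive.

Import Order.TTheory GRing.Theory Num.Theory.

Local Open Scope classical_set_scope.
Local Open Scope ring_scope.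

Lemma grid_pointP (R : realType) (h : R) (x : grid h) :
  exists k, x = grid_point h k.
Proof.
have := valP x; rewrite inE => -[k _ kx]; exists k.
by apply: val_inj; rewrite /= kx.
Qed.

Lemma grid_shift_point (R : realType) (h : R) (j k : int) :
  grid_shift (grid_point h j) k = grid_point h (j + k).
Proof. by apply: val_inj; rewrite /= intrD mulrDl. Qed.

(** A point of [grid h] does not carry its index. For positive [h] the quotient is already an
    integer, and the floor only serves to land in [int]. *)
Definition grid_index (R : realType) (h : R) (x : grid h) : int :=
  Num.floor (val x / h).

Lemma grid_pointK (R : realType) (h : R) :
  0 < h -> cancel (grid_point h) (@grid_index R h).
Proof.
by move=> h_gt0 k; rewrite /grid_index /= mulfK ?lt0r_neq0 // intrKfloor.
Qed.

Lemma stencil_op_centred (R : realType) (h : R) (c : R[i]) (s : seq R[i])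
    (u : gridfun h) (x : grid h) :
  stencil_op (centred_stencil c s) u x =
  \sum_(0 <= i < size s) c * s`_i * u (grid_shift x (i%:Z - (size s)./2%:Z)).
Proof.
set m := (size s)./2%:Z; set K := [fset i%:Z - m | i in iota 0 (size s)]%fset.
rewrite /stencil_op /index_iota subn0.
(* The support may be smaller than [K], since some product [c * s_i] may be zero; the additional
   terms vanish. *)
transitivity (\sum_(k <- K) centred_stencil c s k * u (grid_shift x k)).
  apply: big_fset_incl => [|k kK kN]; first exact: finsupp_sub.
  by rewrite (fsfun_dflt kN) mul0r.
rewrite big_imfset /=; last first.
  by move=> i k _ _ /addIr [].
rewrite undup_id ?iota_uniq //.
rewrite big_seq [in RHS]big_seq; apply: eq_bigr => i si.
rewrite /centred_stencil fsfunE -/m -/K.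
have -> : i%:Z - m \in K by apply/imfsetP; exists i.
by rewrite subrK absz_nat.
Qed.

Lemma stencil_op_sum (R : realType) (h : R) (s : stencil R) (I : finType)
    (a : I -> R[i]) (u : I -> gridfun h) (x : grid h) :
  stencil_op s (fun y => \sum_i a i * u i y) x =
  \sum_i a i * stencil_op s (u i) x.
Proof.
rewrite /stencil_op; under eq_bigr do rewrite mulr_sumr.
rewrite exchange_big; apply: eq_bigr => i _; rewrite mulr_sumr.
by apply: eq_bigr => k _; rewrite mulrCA.
Qed.

Section Patch.
Variables (R : realType) (h : R) (Y : {fset grid h}).

Lemma patch_point_in (a : 'I_#|{: Y}|) : patch_point a \in Y.
Proof. exact: valP. Qed.

Lemma patch_point_inj : injective (@patch_point R h Y).
Proof. by move=> a b /val_inj /enum_val_inj. Qed.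

Lemma patch_pointP (x : grid h) :
  x \in Y -> exists a : 'I_#|{: Y}|, x = patch_point a.
Proof.
by move=> xY; exists (enum_rank [` xY]%fset); rewrite /patch_point enum_rankK.
Qed.

Lemma sum_patch_point (F : grid h -> R[i]) :
  \sum_(a < #|{: Y}|) F (patch_point a) = \sum_(y <- Y) F y.
Proof.
rewrite (big_seq_fsetE _ _ xpredT) /=.
rewrite (reindex (enum_val (A := {: Y}))) //.
by apply: onW_bij; apply: enum_val_bij.
Qed.

Lemma patch_extend_in (v : 'cV[R[i]]_#|{: Y}|) (a : 'I_#|{: Y}|) :
  patch_extend v (patch_point a) = v a 0.
Proof.
by rewrite /patch_extend (big_pred1 a) // => b; rewrite (inj_eq patch_point_inj).
Qed.

Lemma patch_extend_out (v : 'cV[R[i]]_#|{: Y}|) (x : grid h) :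
  x \notin Y -> patch_extend v x = 0.
Proof.
move=> xNY; rewrite /patch_extend big_pred0 // => a.
by apply: contraNF xNY => /eqP <-; exact: patch_point_in.
Qed.

(** The columns of the patch matrix come from the extended basis vectors, [patch_extend v] is their
    combination with the entries of [v] as coefficients, and a stencil operator is linear. Matrix
    products can thus be evaluated by the stencil. *)
Lemma patch_matrix_mul (s : stencil R) (v : 'cV[R[i]]_#|{: Y}|) :
  patch_matrix (stencil_op s) Y *m v =
  patch_restrict Y (stencil_op s (patch_extend v)).
Proof.
apply/colP => a; rewrite !mxE.
have -> : patch_extend v =
    (fun y => \sum_b v b 0 * patch_extend (delta_mx b 0 : 'cV_#|{: Y}|) y).
  apply/funext => y; rewrite /patch_extend.
  under [RHS]eq_bigr do rewrite mulr_sumr.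
  rewrite exchange_big; apply: eq_bigr => b _ /=.
  rewrite (bigD1 b) //= big1 => [|d dNb]; first by rewrite mxE !eqxx mulr1 addr0.
  by rewrite mxE eq_sym (negPf dNb) mulr0.
by rewrite stencil_op_sum; apply: eq_bigr => b _; rewrite !mxE mulrC.
Qed.

End Patch.

(* Four times the Dirichlet Green's function of [-1 2 -1] on the interval
   (-2, 2). As it vanishes at m = -2 and m = 2, it agrees there with its
   extension by zero. *)
Definition dirichlet_green (m n : int) : int :=
  (Num.min m n + 2) * (2 - Num.max m n).

(** The Green's function equation for [-1 2 -1], rearranged to avoid signs. All values are integers,
    so the nine cases hold by computation. *)
Lemma dirichlet_green_laplacian (m n : int) :
  m \in [:: -1; 0; 1] -> n \in [:: -1; 0; 1] ->
  2 * dirichlet_green m n =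
    dirichlet_green (m - 1) n + dirichlet_green (m + 1) n + 4 * (m == n)%:R.
Proof. by rewrite !inE => /or3P[] /eqP -> /or3P[] /eqP ->. Qed.

(** A kernel on grid points rather than on patch indices, so it does not depend on the enumeration
    and also has values next to the patch. Subtracting [j] moves the patch to -1, 0, 1. *)
Definition patch_green (R : realType) (h : R) (j : int) (x y : grid h) : R[i] :=
  h%:C%C ^+ 2 / 4 *
  (dirichlet_green (grid_index x - j) (grid_index y - j))%:~R.

Section VertexPatch.
Variables (R : realType) (h : R) (h_gt0 : 0 < h).

Let A_h : gridfun h -> gridfun h :=
  stencil_op (centred_stencil (h%:C%C ^- 2) [:: -1; 2; -1]).

Lemma in_vertex_patch (j k : int) :
  (grid_point h k \in vertex_patch h j) =
  [|| k == j - 1, k == j | k == j + 1].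
Proof. by rewrite !inE !(inj_eq (grid_point_inj h_gt0)) orbA. Qed.

Lemma sum_vertex_patch (j : int) (F : grid h -> R[i]) :
  \sum_(a < #|{: vertex_patch h j}|) F (patch_point a) =
  F (grid_point h (j - 1)) + F (grid_point h j) + F (grid_point h (j + 1)).
Proof.
have inj := inj_eq (grid_point_inj h_gt0).
rewrite sum_patch_point /vertex_patch.
rewrite fsetUC big_fsetU1 /=; last first.
  by rewrite !inE !inj; lia.
rewrite big_fsetU1 /= ?big_seq_fset1; first by rewrite addrC.
by rewrite !inE inj; lia.
Qed.

Definition green_mx (j : int) : 'M[R[i]]_#|{: vertex_patch h j}| :=
  \matrix_(a, b) patch_green j (patch_point a) (patch_point b).

Lemma vertex_patch_point (j : int) (a : 'I_#|{: vertex_patch h j}|) :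
  exists2 n, n \in [:: -1; 0; 1] & patch_point a = grid_point h (j + n).
Proof.
have := patch_point_in a; have [k ->] := grid_pointP (patch_point a).
rewrite in_vertex_patch.
by case/or3P => /eqP ->; [exists (-1)|exists 0; rewrite ?addr0|exists 1].
Qed.

(** Applied at a patch point, the three-point stencil reaches offsets up to 2 in absolute value. At
    the two offsets outside the patch both sides are zero. *)
Lemma patch_extend_green (j d : int) (b : 'I_#|{: vertex_patch h j}|) :
  d \in [:: -2; -1; 0; 1; 2] ->
  patch_extend (col b (green_mx j)) (grid_point h (j + d)) =
  patch_green j (grid_point h (j + d)) (patch_point b).
Proof.
move=> dI.
have [jdY|jdN] := boolP (grid_point h (j + d) \in vertex_patch h j).
  by have [a ->] := patch_pointP jdY; rewrite patch_extend_in !mxE.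
rewrite patch_extend_out //; have [n nI ->] := vertex_patch_point b.
have {dI jdN} : (d == -2) || (d == 2).
  by move: dI jdN; rewrite in_vertex_patch !inE; lia.
rewrite /patch_green !grid_pointK // !(addrC j) !addrK; move: nI; rewrite !inE.
by case/or3P => /eqP -> /orP[] /eqP ->;
  rewrite [dirichlet_green _ _](_ : _ = 0) // mulr0.
Qed.

(** Column [b] of [green_mx j], extended by zero, is the Green's function with its source at the
    point of [b]; [A_h] maps it to a unit vector on the patch. *)
Lemma vertex_patch_matrix_green (j : int) :
  patch_matrix A_h (vertex_patch h j) *m green_mx j = 1%:M.
Proof.
have h_neq0 : h%:C%C != 0 :> R[i].
  by rewrite eq_complex /= eqxx andbT lt0r_neq0.
apply/matrixP => a b; rewrite [RHS]mxE -(inj_eq (@patch_point_inj _ _ _)).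
transitivity ((patch_matrix A_h (vertex_patch h j) *m col b (green_mx j)) a 0).
  by rewrite !mxE; apply: eq_bigr => d _; rewrite !mxE.
rewrite patch_matrix_mul mxE stencil_op_centred.
have [m mI ->] := vertex_patch_point a; have [n nI En] := vertex_patch_point b.
rewrite /index_iota !big_cons big_nil !grid_shift_point -!addrA /=.
rewrite !patch_extend_green; try by move: mI; rewrite !inE => /or3P[] /eqP ->.
rewrite En (inj_eq (grid_point_inj h_gt0)) (inj_eq (addrI _)) /patch_green.
rewrite !grid_pointK // !(addrC j) !addrK.
have /(congr1 (fun z : int => z%:~R : R[i])) := dirichlet_green_laplacian mI nI.
rewrite rmorphM !rmorphD rmorphM /= -pmulrn => E.
rewrite sub0r subrr addr0 (_ : 2%Z - 1%Z = 1) //; set g := dirichlet_green m n in E *.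
set gl := dirichlet_green _ _ in E *; set gr := dirichlet_green _ _ in E *.
(* The scaling of [A_h] cancels the factor [h%:C%C ^+ 2] of [patch_green], leaving only the division
   by 4. *)
transitivity (((1 + 1) * g%:~R - gl%:~R - gr%:~R) / 4 : R[i]); first by field.
by rewrite E; field.
Qed.

Lemma vertex_patch_count (x : grid h) :
  patch_count (vertex_patches h_gt0) x = 3%N.
Proof.
have [k ->] := grid_pointP x; rewrite /patch_count.
have -> : [set j | grid_point h k \in vertex_patches h_gt0 j] =
    [set` [fset (k - 1)%R; k; (k + 1)%R]%fset].
  apply/seteqP; split=> j /=; rewrite in_vertex_patch !inE -orbA.
    by case/or3P => /eqP ->; rewrite ?subrK ?addrK eqxx ?orbT.
  by case/or3P => /eqP ->; rewrite ?subrK ?addrK eqxx ?orbT.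
by rewrite set_fsetK fsetUC cardfsU1 cardfs2 !inE; lia.
Qed.

(** The contribution of a single patch, with [m] the offset of the evaluation point from the patch
    centre. The 12 is 3 * 4: the patch count in the weight times the normalisation of
    [dirichlet_green]. *)
Lemma vanka_vertex_patch (j m : int) (u : gridfun h) :
  m \in [:: -1; 0; 1] ->
  patch_extend
    (patch_weight (vertex_patches h_gt0) j *m
      invmx (patch_matrix A_h (vertex_patches h_gt0 j)) *m
      patch_restrict (vertex_patches h_gt0 j) u) (grid_point h (j + m)) =
  h%:C%C ^+ 2 / 12 *
  ((dirichlet_green m (-1))%:~R * u (grid_point h (j - 1)) +
   (dirichlet_green m 0)%:~R * u (grid_point h j) +
   (dirichlet_green m 1)%:~R * u (grid_point h (j + 1))).
Proof.
move=> mI; have jmY : grid_point h (j + m) \in vertex_patch h j.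
  by move: mI; rewrite in_vertex_patch !inE; lia.
have [a ja] := patch_pointP jmY; rewrite ja (patch_extend_in _ a).
(* A right inverse of a square matrix already makes it a unit, so [invmx] is the true inverse
   here. *)
have mxK := vertex_patch_matrix_green j; have [mxU _] := mulmx1_unit mxK.
have -> : invmx (patch_matrix A_h (vertex_patches h_gt0 j)) = green_mx j.
  by rewrite -[LHS]mulmx1 -mxK mulKmx.
rewrite -mulmxA mul_diag_mx !mxE vertex_patch_count.
rewrite (eq_bigr (fun b =>
  patch_green j (patch_point a) (patch_point b) * u (patch_point b))); last first.
  by move=> b _; rewrite !mxE.
rewrite (sum_vertex_patch j (fun y => patch_green j (patch_point a) y * u y)).
rewrite -ja /patch_green !grid_pointK // !(addrC j) !addrK addNr.
by field.
Qed.

End VertexPatch.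

Theorem mainTheorem9 (R : realType) (h : R) (h_gt0 : 0 < h) :
  let A_h : gridfun h -> gridfun h :=
    stencil_op (centred_stencil (h%:C%C ^- 2) [:: -1; 2; -1]) in
  let M_v : gridfun h -> gridfun h := vanka (vertex_patches h_gt0) A_h in
  (forall j : int, patch_matrix A_h (vertex_patches h_gt0 j) \in unitmx) /\
  M_v = stencil_op (centred_stencil (h%:C%C ^+ 2 / 12) [:: 1; 4; 10; 4; 1]).
Proof.
split=> [j|]; first by case/mulmx1_unit: (vertex_patch_matrix_green h_gt0 j).
apply/funext => u; apply/funext => x; have [k ->] := grid_pointP x.
(* Every patch other than these three misses the point, and its extension by zero contributes
   nothing. *)
rewrite /vanka (@fsbigE _ _ _ _ _ [:: k - 1; k; k + 1]) //=; first last.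
- move=> j _ jN; rewrite patch_extend_out //.
  by apply: contraNN jN; rewrite in_vertex_patch // !inE; lia.
- by rewrite !inE; lia.
rewrite !big_cons big_nil !in_setT.
have := @vanka_vertex_patch _ _ h_gt0 (k - 1) 1 u isT; rewrite subrK => ->.
have := @vanka_vertex_patch _ _ h_gt0 k 0 u isT; rewrite addr0 => ->.
have := @vanka_vertex_patch _ _ h_gt0 (k + 1) (-1) u isT; rewrite addrK => ->.
rewrite stencil_op_centred /index_iota !big_cons big_nil /= !grid_shift_point.
(* The offsets are put in the form in which the patch contributions produce them, so that [field]
   sees the same values of [u] on both sides. *)
have -> : k + (0%:Z - 2%:Z) = k - 1 - 1 by lia.
have -> : k + (1%:Z - 2%:Z) = k - 1 by lia.
have -> : k + (2%:Z - 2%:Z) = k by lia.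
have -> : k + (3%:Z - 2%:Z) = k + 1 by lia.
have -> : k + (4%:Z - 2%:Z) = k + 1 + 1 by lia.
have [-> -> ->] : [/\ dirichlet_green 1 (-1) = 1, dirichlet_green 1 0 = 2 &
  dirichlet_green 1 1 = 3] by [].
have [-> -> ->] : [/\ dirichlet_green 0 (-1) = 2, dirichlet_green 0 0 = 4 &
  dirichlet_green 0 1 = 2] by [].
have [-> -> ->] : [/\ dirichlet_green (-1) (-1) = 3,
  dirichlet_green (-1) 0 = 2 & dirichlet_green (-1) 1 = 1] by [].
(* The coefficients add up to 1, 2 + 2, 3 + 4 + 3, 2 + 2, 1. *)
by field.
Qed.
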